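(* Let $w_1,w_2,w_3$ be positive integers, $n\ge0$ an integer, and $y_1,y_2\in\mathbb{Z}_p$. Then \begin{align*} &\sum_{k+l+m=n}\binom{n}{k,l,m}B_{k,q^{w_2w_3}}(w_1y_1)B_{l,q^{w_1w_3}}(w_2y_2)S_{m,q^{w_1w_2}}(w_3-1)\,w_1^{l+m}w_2^{k+m}w_3^{k+l-1}\\ &=\sum_{k+l+m=n}\binom{n}{k,l,m}B_{k,q^{w_2w_3}}(w_1y_1)B_{l,q^{w_1w_2}}(w_3y_2)S_{m,q^{w_1w_3}}(w_2-1)\,w_1^{l+m}w_3^{k+m}w_2^{k+l-1}\\ &=\sum_{k+l+m=n}\binom{n}{k,l,m}B_{k,q^{w_1w_3}}(w_2y_1)B_{l,q^{w_2w_3}}(w_1y_2)S_{m,q^{w_1w_2}}(w_3-1)\,w_2^{l+m}w_1^{k+m}w_3^{k+l-1}\\ &=\sum_{k+l+m=n}\binom{n}{k,l,m}B_{k,q^{w_1w_3}}(w_2y_1)B_{l,q^{w_1w_2}}(w_3y_2)S_{m,q^{w_2w_3}}(w_1-1)\,w_2^{l+m}w_3^{k+m}w_1^{k+l-1}\\ &=\sum_{k+l+m=n}\binom{n}{k,l,m}B_{k,q^{w_1w_2}}(w_3y_1)B_{l,q^{w_1w_3}}(w_2y_2)S_{m,q^{w_2w_3}}(w_1-1)\,w_3^{l+m}w_2^{k+m}w_1^{k+l-1}\\ &=\sum_{k+l+m=n}\binom{n}{k,l,m}B_{k,q^{w_1w_2}}(w_3y_1)B_{l,q^{w_2w_3}}(w_1y_2)S_{m,q^{w_1w_3}}(w_2-1)\,w_3^{l+m}w_1^{k+m}w_2^{k+l-1}.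 \end{align*}
   Context: Let $p$ be a prime, $\mathbb{C}_p$ the completion of an algebraic closure of $\mathbb{Q}_p$, and $|\cdot|_p$ the absolute value on $\mathbb{C}_p$ with $|p|_p=1/p$. Fix $q\in\mathbb{C}_p$ with $q\neq 1$ and $|q-1|_p<p^{-1/(p-1)}$; for every positive integer $w$, $Q=q^w$ also satisfies these conditions. For such $Q$, the $Q$-Bernoulli numbers are defined by $\frac{\log Q+t}{Qe^t-1}=\sum_{n\ge0}B_{n,Q}\frac{t^n}{n!}$ ($\log$ the $p$-adic logarithm), and the $Q$-Bernoulli polynomials by $\frac{\log Q+t}{Qe^t-1}e^{xt}=\sum_{n\ge0}B_{n,Q}(x)\frac{t^n}{n!}$, i.e. $B_{n,Q}(x)=\sum_{j=0}^n\binom{n}{j}B_{j,Q}x^{n-j}$. For integers $k\ge0$, $N\ge0$, the $Q$-analogue of the power sum is $S_{k,Q}(N)=\sum_{i=0}^N i^kQ^i$, with the convention $0^0=1$. The sum $\sum_{k+l+m=n}$ runs over nonnegative integers $k,l,m$ with $k+l+m=n$, and $\binom{n}{k,l,m}=\frac{n!}{k!\,l!\,m!}$. *)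

(* Defs.v *)
From HB Require Import structures.
From mathcomp Require Import all_boot all_order all_algebra.
From mathcomp Require Import all_classical all_reals all_analysis.

Set Implicit Arguments.
Unset Strict Implicit.
Unset Printing Implicit Defensive.
Import Order.TTheory GRing.Theory Num.Theory.
Import numFieldNormedType.Exports.
Local Open Scope classical_set_scope.
Local Open Scope ring_scope.

(* The field C_p is presented by its defining property: a field K with an
   absolute value absv is C_p when it is a completion of an algebraic closure of
   Q_p (complete, with the algebraic closure of Q_p as a dense subset), Q_p being
   itself the completion of the rationals, i.e. their closure in K.  This
   determines (K, absv) up to isometric isomorphism. *)
Section Cp.
Variables (R : realType) (K : fieldType) (absv : K -> R).

Definition kcvg (u : nat -> K) (l : K) : Prop :=
  absv (u n - l) @[n --> \oo] --> (0 : R).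

Definition kcauchy (u : nat -> K) : Prop :=
  forall e : R, 0 < e ->
    exists N : nat, forall m n, (N <= m)%N -> (N <= n)%N -> absv (u m - u n) < e.

Definition kclosure (S : set K) : set K :=
  [set x | forall e : R, 0 < e -> exists2 y, S y & absv (x - y) < e].

Definition padicQ : set K := kclosure (range (@ratr K)).

Definition padicZ : set K := [set x | padicQ x /\ absv x <= 1].

Definition padicQbar : set K :=
  [set x | exists f : {poly K}, [/\ f != 0, forall i, padicQ f`_i & root f x]].

Record is_Cp (p : nat) : Prop := {
  absv_ge0 : forall x, 0 <= absv x;
  absv_eq0 : forall x, absv x = 0 <-> x = 0;
  absvM : forall x y, absv (x * y) = absv x * absv y;
  absv_ultra : forall x y, absv (x + y) <= Num.max (absv x) (absv y);
  absv_p : absv p%:R = p%:R^-1;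
  Cp_complete : forall u, kcauchy u -> exists l, kcvg u l;
  padicQbar_closed : forall f : {poly K},
    (forall i, padicQbar f`_i) -> (1 < size f)%N -> exists2 x, padicQbar x & root f x;
  padicQbar_dense : forall x, kclosure padicQbar x
}.

(* Sum of the series of log (1 + (x - 1)); it converges for absv (x - 1) < 1,
   and the value is 0 where it does not. *)
Definition plog (x : K) : K :=
  xget 0 [set l | kcvg
    (fun n => \sum_(1 <= i < n) (-1) ^+ i.+1 * (x - 1) ^+ i / i%:R) l].

End Cp.

(* Formal power series over K, as sequences of coefficients. *)
Section FormalPowerSeries.
Variable K : fieldType.
Implicit Types f g : nat -> K.

Definition fps_mul f g : nat -> K :=
  fun n => \sum_(i < n.+1) f i * g (n - i)%N.

(* The first n coefficients of 1 / f, for f with nonzero constant term. *)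
Fixpoint fps_inv_seq f (n : nat) : seq K :=
  if n is n'.+1 then
    let s := fps_inv_seq f n' in
    rcons s ((f 0%N)^-1 * ((n' == 0%N)%:R - \sum_(i < n') s`_i * f (n' - i)%N))
  else [::].

Definition fps_inv f : nat -> K := fun n => (fps_inv_seq f n.+1)`_n.

Definition fps_exp (x : K) : nat -> K := fun n => x ^+ n / n`!%:R.

Lemma size_fps_inv_seq f n : size (fps_inv_seq f n) = n.
Proof. by elim: n => //= n IHn; rewrite size_rcons IHn. Qed.

Lemma nth_fps_inv_seq f n i : (i < n)%N -> (fps_inv_seq f n)`_i = fps_inv f i.
Proof.
elim: n => // n IHn; rewrite ltnS leq_eqVlt => /orP[/eqP->|lt_in]; first by [].
by rewrite /= nth_rcons size_fps_inv_seq lt_in IHn.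
Qed.

Lemma fps_mulVf f : f 0%N != 0 ->
  forall n, fps_mul (fps_inv f) f n = (n == 0%N)%:R.
Proof.
move=> f0 n; rewrite /fps_mul big_ord_recr /= subnn.
rewrite {2}/fps_inv /= nth_rcons size_fps_inv_seq ltnn eqxx.
rewrite mulrAC mulVf // mul1r addrC -[RHS]addr0 -addrA; congr (_ + _).
apply/eqP; rewrite addrC subr_eq0; apply/eqP/eq_bigr => i _.
by rewrite nth_fps_inv_seq.
Qed.

End FormalPowerSeries.

Section QBernoulli.
Variables (R : realType) (K : fieldType) (absv : K -> R).

(* (log Q + t) / (Q e^t - 1) *)
Definition qbern_gf (Q : K) : nat -> K :=
  fps_mul (fun n => ((plog absv Q)%:P + 'X)`_n)
          (fps_inv (fun n => Q * fps_exp 1 n - (n == 0%N)%:R)).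

Definition qbern_num (Q : K) (n : nat) : K := n`!%:R * qbern_gf Q n.

Definition qbern (Q : K) (n : nat) (x : K) : K :=
  n`!%:R * fps_mul (qbern_gf Q) (fps_exp x) n.

Lemma qbernE (Q : K) n x : (forall i, i`!%:R != 0 :> K) ->
  qbern Q n x = \sum_(j < n.+1) 'C(n, j)%:R * qbern_num Q j * x ^+ (n - j).
Proof.
move=> fact_neq0; rewrite /qbern /fps_mul mulr_sumr; apply: eq_bigr => j _.
have le_jn : (j <= n)%N by rewrite -ltnS.
rewrite /qbern_num /fps_exp -(bin_fact le_jn) !natrM.
rewrite [in RHS]mulrA -!mulrA; congr (_ * (_ * _)).
by rewrite mulrCA; congr (_ * _); rewrite mulrCA mulfV ?mulr1.
Qed.

End QBernoulli.

Definition qpowsum (K : fieldType) (Q : K) (k N : nat) : K :=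
  \sum_(i < N.+1) i%:R ^+ k * Q ^+ i.

Definition trinomial_sum (K : fieldType) (n : nat) (F : nat -> nat -> nat -> K) : K :=
  \sum_(k < n.+1) \sum_(l < n.+1) \sum_(m < n.+1 | (k + l + m)%N == n)
     n`!%:R / (k`!%:R * l`!%:R * m`!%:R) * F k l m.

(* Main.v *)
(** With [U = q e^t] and [L = log q + t], the exponential generating function in
    [n] of the expression attached to [(w1, w2, w3)] is
<<
      w1 w2 w3 L^2 (U^(w1 w2 w3) - 1) e^(w1 w2 w3 (y1 + y2) t)
      / ((U^(w1 w2) - 1) (U^(w1 w3) - 1) (U^(w2 w3) - 1)),
>>
    which is symmetric in [w1, w2, w3].  This rests on two p-adic facts.  First,
    [q ^ w <> 1], by comparing the absolute values of the terms of
    [(1 + (q - 1)) ^ p - 1].  Second, [log (q ^ w) = w log q], which follows from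
    [log x = lim (x ^ (p ^ n) - 1) / p ^ n]. *)

Require Import Defs.
From HB Require Import structures.
From mathcomp Require Import all_boot all_order all_algebra.
From mathcomp Require Import all_classical all_reals all_analysis.
From mathcomp Require Import ring zify.

Set Implicit Arguments.
Unset Strict Implicit.
Unset Printing Implicit Defensive.
Import Order.TTheory GRing.Theory Num.Theory.
Import numFieldNormedType.Exports.
Local Open Scope classical_set_scope.
Local Open Scope ring_scope.

(** * The ring of formal power series *)

(* [nat -> K] itself already carries the pointwise product; the ring structure
   put on this alias is the Cauchy product. *)
Definition fps (K : fieldType) := nat -> K.

HB.instance Definition _ (K : fieldType) := Choice.copy (fps K) (nat -> K).
HB.instance Definition _ (K : fieldType) :=
  GRing.Zmodule.copy (fps K) (nat -> K).

Section FpsRing.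
Variable K : fieldType.
Implicit Types f g h : fps K.

Definition fps_one : fps K := fun n => (n == 0%N)%:R.

(** The coefficient of index [n] of a Cauchy product involves only coefficients of index at most
    [n]. Truncation therefore carries the ring laws over from polynomials. *)
Lemma fps_mul_poly N f g n : (n < N)%N ->
  fps_mul f g n = (\poly_(i < N) f i * \poly_(i < N) g i)`_n.
Proof.
move=> nN; rewrite coefM; apply: eq_bigr => i _; rewrite !coef_poly.
by rewrite (leq_ltn_trans (leq_subr i n)) // (leq_ltn_trans _ nN) // -ltnS.
Qed.

Lemma fps_mulC : commutative (@fps_mul K : fps K -> fps K -> fps K).
Proof.
by move=> f g; apply/funext => n; rewrite !(fps_mul_poly _ _ (ltnSn n)) mulrC.
Qed.

Lemma fps_mulA : associative (@fps_mul K : fps K -> fps K -> fps K).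
Proof.
move=> f g h; apply/funext => n; transitivity
  ((\poly_(i < n.+1) f i * (\poly_(i < n.+1) g i * \poly_(i < n.+1) h i))`_n).
  rewrite coefM; apply: eq_bigr => i _; rewrite coef_poly ltn_ord.
  by rewrite -fps_mul_poly // ltnS leq_subr.
rewrite mulrA coefM; apply: eq_bigr => i _; rewrite coef_poly ltnS leq_subr.
by rewrite -fps_mul_poly.
Qed.

Lemma fps_mul1 : left_id fps_one (@fps_mul K : fps K -> fps K -> fps K).
Proof.
move=> f; apply/funext => n; rewrite /fps_mul big_ord_recl /= /fps_one /=.
by rewrite mul1r subn0 big1 ?addr0 // => i _; rewrite mul0r.
Qed.

Lemma fps_mulDl :
  left_distributive (@fps_mul K : fps K -> fps K -> fps K) +%R.
Proof.
move=> f g h; apply/funext => n.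
transitivity (fps_mul f h n + fps_mul g h n) => //.
by rewrite -big_split; apply: eq_bigr => i _; exact: mulrDl.
Qed.

Lemma fps_one_neq0 : fps_one != 0 :> fps K.
Proof.
apply/eqP => /(congr1 (fun f : fps K => f 0%N)); rewrite /fps_one /=.
by move/eqP; rewrite oner_eq0.
Qed.

HB.instance Definition _ := GRing.Zmodule_isComNzRing.Build (fps K)
  fps_mulA fps_mulC fps_mul1 fps_mulDl fps_one_neq0.

Lemma fpsME f g n : (f * g) n = fps_mul f g n. Proof. by []. Qed.

Lemma fpsDE f g n : (f + g) n = f n + g n. Proof. by []. Qed.

Lemma fpsBE f g n : (f - g) n = f n - g n. Proof. by []. Qed.

Lemma fps1E n : (1 : fps K) n = (n == 0%N)%:R. Proof. by []. Qed.

Lemma fps_sumE (I : Type) (r : seq I) (F : I -> fps K) n :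
  (\sum_(i <- r) F i) n = \sum_(i <- r) F i n.
Proof. by elim/big_rec2: _ => // i f x _ <-. Qed.

Lemma fps_natlE m f n : (m%:R * f) n = m%:R * f n.
Proof. by rewrite !mulr_natl; elim: m => // m IHm; rewrite !mulrSr fpsDE IHm. Qed.

Lemma fps_mulVr f : f 0%N != 0 -> (fps_inv f : fps K) * f = 1.
Proof. by move=> f0; apply/funext => n; rewrite fpsME fps_mulVf. Qed.

(** The substitution of [c t] for the variable [t]. *)
Definition fps_scale (c : K) f : fps K := fun n => c ^+ n * f n.

Lemma fps_scaleM c f g : fps_scale c (f * g) = fps_scale c f * fps_scale c g.
Proof.
apply/funext => n; rewrite /fps_scale fpsME /fps_mul mulr_sumr.
apply: eq_bigr => i _; rewrite mulrACA -exprD subnKC //.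
by rewrite -ltnS.
Qed.

Lemma fps_scale1 c : fps_scale c 1 = 1.
Proof. by apply/funext => -[|n]; rewrite /fps_scale fps1E ?mulr1 ?mulr0. Qed.

(* [fps_exp x], retyped so that [*] is the Cauchy product. *)
Definition expf (x : K) : fps K := fps_exp x.

Lemma fps_scale_exp c x : fps_scale c (expf x) = expf (c * x).
Proof.
by apply/funext => n; rewrite /fps_scale /expf /fps_exp exprMn mulrA.
Qed.

Lemma expfD x y : (forall i, i`!%:R != 0 :> K) ->
  expf (x + y) = expf x * expf y.
Proof.
move=> fact0; apply/funext => n; rewrite fpsME /fps_mul /expf /fps_exp addrC exprDn.
rewrite mulr_suml; apply: eq_bigr => i _.
have le_in : (i <= n)%N by rewrite -ltnS.
rewrite -(bin_fact le_in) !natrM -mulr_natr.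
(* The binomial coefficient divides [n!], which is nonzero in [K]. *)
have bin0 : 'C(n, i)%:R != 0 :> K.
  by have := fact0 n; rewrite -(bin_fact le_in) natrM mulf_eq0 => /norP[].
by field; rewrite !fact0.
Qed.

(* The multinomial coefficients turn a trinomial sum into a coefficient of a
   product of exponential generating functions. *)
Lemma trinomial_sum_fps f g h (F : nat -> nat -> nat -> K) d n :
    (forall i, i`!%:R != 0 :> K) ->
    (forall k l m, F k l m =
       d * ((k`!%:R * f k) * (l`!%:R * g l) * (m`!%:R * h m))) ->
  trinomial_sum n F = n`!%:R * (d * (f * g * h) n).
Proof.
move=> fact0 FE; rewrite -mulrA fpsME /fps_mul.
transitivity (n`!%:R * (d * \sum_(k < n.+1) \sum_(l < n.+1 | (l <= n - k)%N)
                           (f k * (g l * h (n - k - l)%N)))).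
  rewrite !mulr_sumr; apply: eq_bigr => k _; rewrite !mulr_sumr.
  rewrite [RHS]big_mkcond; apply: eq_bigr => l _.
  have le_kn : (k <= n)%N by rewrite -ltnS.
  case: ifPn => [le_l|gt_l].
    have lt_m : (n - k - l < n.+1)%N by rewrite ltnS -subnDA leq_subr.
    (* Once [k + l <= n], the only index left is [m = n - k - l]; otherwise the inner sum is
       empty. *)
    rewrite (big_pred1 (Ordinal lt_m)) => [/=|m]; last first.
      by rewrite /= -[in RHS](inj_eq val_inj) /=; lia.
    by rewrite FE; field; rewrite !fact0.
  by rewrite big_pred0 // => m; apply/negbTE; move: gt_l; lia.
congr (_ * (_ * _)); apply: eq_bigr => k _; rewrite fpsME /fps_mul mulr_sumr.
have le_kn : ((n - k).+1 <= n.+1)%N by rewrite ltnS leq_subr.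
rewrite (big_ord_widen _ (fun l => f k * (g l * h (n - k - l)%N)) le_kn).
by apply: eq_bigl => l; rewrite ltnS.
Qed.

End FpsRing.

(** * The p-adic absolute value and logarithm *)

Section RealSequences.
Variable R : realType.

Lemma expr_small (r C e : R) : 0 <= r -> r < 1 -> 0 < e ->
  exists N : nat, forall n, (N <= n)%N -> C * r ^+ n < e.
Proof.
move=> r0 r1 e0.
have /cvgrPdist_lt/(_ (e / (`|C| + 1))) : r ^+ n @[n --> \oo] --> (0 : R).
  by apply: cvg_expr; rewrite ger0_norm.
have C1 : 0 < `|C| + 1 by rewrite ltr_wpDl.
rewrite divr_gt0// => /(_ isT)[N _ HN]; exists N => n /HN /=.
rewrite sub0r normrN ger0_norm ?exprn_ge0// ltr_pdivlMr// mulrC.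
apply: le_lt_trans; rewrite ler_wpM2r ?exprn_ge0//.
by rewrite (le_trans (ler_norm _))// lerDl.
Qed.

(** With [s = sqrt r], each of the first [n] powers of [s] is at least [s^n], so [n s^n] is at most
    the geometric sum, hence at most [1 / (1 - s)]. Thus [n r^n <= s^n / (1 - s)]. *)
Lemma natr_expr_small (r e : R) : 0 <= r -> r < 1 -> 0 < e ->
  exists N : nat, forall n, (N <= n)%N -> n%:R * r ^+ n < e.
Proof.
move=> r0 r1 e0; pose s := Num.sqrt r.
have s0 : 0 <= s by exact: sqrtr_ge0.
have s1 : s < 1 by rewrite -sqrtr1 ltr_sqrt.
have rE : r = s * s by rewrite -expr2 sqr_sqrtr.
have [N HN] := expr_small (1 - s)^-1 s0 s1 e0.
exists N => n /HN; apply: le_lt_trans; rewrite rE exprMn mulrA.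
rewrite ler_wpM2r ?exprn_ge0// -[leRHS]mul1r ler_pdivlMr ?subr_gt0//.
have geo : (1 - s) * \sum_(i < n) s ^+ i = 1 - s ^+ n.
  by rewrite -opprB mulNr -subrX1 opprB.
apply: (@le_trans _ _ (1 - s ^+ n)); last by rewrite gerBl exprn_ge0.
rewrite -geo mulrC ler_wpM2l ?subr_ge0 ?(ltW s1)// mulr_natl.
rewrite -[X in _ *+ X]card_ord -sumr_const ler_sum// => i _.
by apply: ler_wiXn2l => //; [exact: ltW | exact: ltnW].
Qed.

End RealSequences.

Section Padic.
Variables (R : realType) (p : nat) (K : fieldType) (absv : K -> R).
Hypotheses (p_prime : prime p) (K_Cp : is_Cp absv p).

Let p_gt0 : 0 < p%:R :> R. Proof. by rewrite ltr0n prime_gt0. Qed.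

Let pV_lt1 : p%:R^-1 < 1 :> R.
Proof. by rewrite invf_lt1// ltr1n prime_gt1. Qed.

(** * Ultrametric estimates and absolute values of integers *)

Lemma absv0 : absv 0 = 0. Proof. exact/(absv_eq0 K_Cp). Qed.

Lemma absv_gt0 x : x != 0 -> 0 < absv x.
Proof.
by move=> /eqP x0; rewrite lt0r (absv_ge0 K_Cp) andbT; apply/eqP => /(absv_eq0 K_Cp).
Qed.

Lemma absv1 : absv 1 = 1.
Proof.
have h : absv 1 != 0 by rewrite gt_eqF// absv_gt0// oner_neq0.
by apply: (mulfI h); rewrite -(absvM K_Cp) !mulr1.
Qed.

Lemma absvX x n : absv (x ^+ n) = absv x ^+ n.
Proof. by elim: n => [|n IHn]; rewrite ?absv1// !exprS (absvM K_Cp) IHn. Qed.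

Lemma absvN x : absv (- x) = absv x.
Proof.
rewrite -mulN1r (absvM K_Cp) -[RHS]mul1r; congr (_ * _).
by apply/eqP; rewrite -(@eqrXn2 _ 2) ?(absv_ge0 K_Cp)// -absvX sqrrN !expr1n absv1.
Qed.

Lemma absvV x : absv x^-1 = (absv x)^-1.
Proof.
have [->|x0] := eqVneq x 0; first by rewrite invr0 absv0 invr0.
have ax := absv_gt0 x0; apply: (mulfI (lt0r_neq0 ax)).
by rewrite -(absvM K_Cp) !divff ?absv1 ?lt0r_neq0.
Qed.

Lemma absvD_lt x y e : absv x < e -> absv y < e -> absv (x + y) < e.
Proof.
by move=> hx hy; apply: le_lt_trans (absv_ultra K_Cp x y) _; rewrite gt_max hx.
Qed.

Lemma absvD_le x y e : absv x <= e -> absv y <= e -> absv (x + y) <= e.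
Proof.
by move=> hx hy; apply: le_trans (absv_ultra K_Cp x y) _; rewrite ge_max hx.
Qed.

Lemma absvB_le x y e : absv x <= e -> absv y <= e -> absv (x - y) <= e.
Proof. by move=> hx hy; apply: absvD_le; rewrite ?absvN. Qed.

Lemma absvB_lt x y e : absv x < e -> absv y < e -> absv (x - y) < e.
Proof. by move=> hx hy; apply: absvD_lt; rewrite ?absvN. Qed.

Lemma absv_distC x y : absv (x - y) = absv (y - x).
Proof. by rewrite -absvN opprB. Qed.

Lemma absv_sum_lt (I : eqType) (r : seq I) (P : pred I) (F : I -> K) e :
    0 < e -> (forall i, i \in r -> P i -> absv (F i) < e) ->
  absv (\sum_(i <- r | P i) F i) < e.
Proof.
move=> e0 hF; rewrite big_seq_cond; apply: (big_ind (fun x => absv x < e)).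
- by rewrite absv0.
- by move=> x y; exact: absvD_lt.
- by move=> i /andP[]; exact: hF.
Qed.

Lemma absv_nat n : absv n%:R <= 1.
Proof.
by elim: n => [|n IHn]; rewrite ?absv0// -natr1 absvD_le// absv1.
Qed.

(** A Bezout relation [1 = u m - k p] would give [absv 1 < 1] if [absv m] were less than [1]. *)
Lemma absv_coprime m : coprime p m -> absv m%:R = 1.
Proof.
move=> cpm; apply/eqP; rewrite eq_le absv_nat leNgt; apply/negP => lt1.
have m0 : (0 < m)%N.
  rewrite lt0n; apply: contraTneq cpm => ->; rewrite /coprime gcdn0.
  by rewrite gtn_eqF ?prime_gt1.
case: (egcdnP p m0) => u k E _; move: E; rewrite gcdnC (eqP cpm) => E.
suff : absv (1 : K) < 1 by rewrite absv1 ltxx.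
have -> : 1 = u%:R * m%:R - k%:R * p%:R :> K.
  by rewrite -!natrM E natrD addrAC subrr add0r.
apply: absvB_lt; rewrite (absvM K_Cp).
  by apply: le_lt_trans lt1; rewrite ler_piMl ?(absv_ge0 K_Cp) ?absv_nat.
rewrite (absv_p K_Cp); apply: le_lt_trans pV_lt1.
by rewrite ler_piMl ?absv_nat ?invr_ge0 ?ler0n.
Qed.

(** Writing [n = m p^v] with [m] prime to [p] gives [absv n = p^(-v)], and [p^v <= n]. This shows
    that [K] has characteristic 0 and that the denominators of the logarithm series cost at most a
    linear factor. *)
Lemma absv_nat_ge n : (0 < n)%N -> n%:R^-1 <= absv n%:R.
Proof.
move=> n0; have [m cpm nE] := pfactor_coprime p_prime n0.
rewrite {2}nE natrM (absvM K_Cp) absv_coprime// mul1r natrX absvX (absv_p K_Cp).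
rewrite exprVn lef_pV2 ?posrE ?exprn_gt0// ?ltr0n// -natrX ler_nat.
by rewrite dvdn_leq// {2}nE dvdn_mull.
Qed.

Lemma natK_neq0 n : (0 < n)%N -> n%:R != 0 :> K.
Proof.
move=> n0; apply/eqP => nE; have := absv_nat_ge n0.
by rewrite nE absv0 invr_le0 leNgt ltr0n n0.
Qed.

Lemma factK_neq0 n : n`!%:R != 0 :> K.
Proof. by rewrite natK_neq0 ?fact_gt0. Qed.

Lemma absv_natV n : absv n%:R^-1 <= n%:R.
Proof.
case: n => [|n]; first by rewrite invr0 absv0.
by rewrite absvV invf_ple ?posrE ?absv_gt0 ?natK_neq0 ?ltr0n// absv_nat_ge.
Qed.

Lemma absv_le1 x : absv (x - 1) < 1 -> absv x <= 1.
Proof. by move=> x1; rewrite -(subrK 1 x) absvD_le ?absv1// ltW. Qed.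

(** The cofactor of [x - 1] in [x^n - 1] is a sum of powers of [x], which lies in the unit ball. *)
Lemma absv_expr_sub1 x n : absv (x - 1) < 1 -> absv (x ^+ n - 1) <= absv (x - 1).
Proof.
move=> x1; rewrite subrX1 (absvM K_Cp) ler_piMr ?(absv_ge0 K_Cp)//.
elim/big_ind: _ => [|a b|i _]; first by rewrite absv0.
  exact: absvD_le.
by rewrite absvX exprn_ile1 ?(absv_ge0 K_Cp) ?absv_le1.
Qed.

(** * Convergence in [K] and the p-adic logarithm *)

Lemma kcvgP (u : nat -> K) l : kcvg absv u l <->
  forall e : R, 0 < e -> exists N : nat, forall n, (N <= n)%N -> absv (u n - l) < e.
Proof.
rewrite /kcvg; split => [/cvgrPdist_lt h e /h [N _ HN]|h].
  exists N => n /HN /=.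
  by rewrite sub0r normrN ger0_norm ?(absv_ge0 K_Cp).
apply/cvgrPdist_lt => e /h [N HN]; exists N => // n /= /HN.
by rewrite sub0r normrN ger0_norm ?(absv_ge0 K_Cp).
Qed.

Lemma kcvg_unique (u : nat -> K) l l' :
  kcvg absv u l -> kcvg absv u l' -> l = l'.
Proof.
move=> /kcvgP ul /kcvgP ul'; apply/eqP; rewrite -subr_eq0; apply/negPn/negP => d0.
have [N HN] := ul _ (absv_gt0 d0); have [N' HN'] := ul' _ (absv_gt0 d0).
have := absvB_lt (HN' _ (leq_maxr N N')) (HN _ (leq_maxl N N')).
by rewrite (_ : _ - _ - _ = l - l') ?ltxx//; ring.
Qed.

(** A limit must be shown to exist in order to exclude the default value of [xget]. The terms are
    bounded by [i * absv (x - 1)^i], so the partial sums are Cauchy by the ultrametric inequality,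
    and [K] is complete. *)
Lemma plog_cvg x : absv (x - 1) < 1 ->
  kcvg absv (fun n => \sum_(1 <= i < n) (-1) ^+ i.+1 * (x - 1) ^+ i / i%:R)
       (plog absv x).
Proof.
move=> x1; rewrite /plog; case: xgetP => // none; exfalso.
set u := fun n : nat => _ in none.
have [|l ul] := Cp_complete K_Cp (u := u); last exact: none ul.
move=> e e0; have [N HN] := natr_expr_small (absv_ge0 K_Cp _) x1 e0.
(* The successor ensures [1 <= n], so that the sum starting at [1] can be split at [n]. *)
exists N.+1 => m n; wlog le_nm : m n / (n <= m)%N.
  by move=> wl hm hn; case/orP: (leq_total n m) => ?; [|rewrite absv_distC]; exact: wl.
move=> _ hn; rewrite /u (big_cat_nat (n := n))//=; last exact: leq_trans hn.
rewrite addrAC subrr add0r; apply: absv_sum_lt => // i; rewrite mem_index_iota.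
move=> /andP[ni _] _; rewrite !(absvM K_Cp) !absvX absvN absv1 expr1n mul1r mulrC.
apply: le_lt_trans (HN i _); last by rewrite (leq_trans _ ni)// ltnW.
by rewrite ler_wpM2r ?exprn_ge0 ?(absv_ge0 K_Cp) ?absv_natV.
Qed.

(** Induction on [j] by Pascal's rule: with [P = p^n], the new term
    [C(P, j+1) = P / (j+1) * C(P-1, j)] has absolute value at most [(j+1) p^(-n)], and the
    ultrametric inequality keeps the errors from adding up. *)
Lemma absv_bin_pexp n j : (j < p ^ n)%N ->
  absv ('C((p ^ n).-1, j)%:R - (-1) ^+ j) <= j%:R * p%:R^-1 ^+ n.
Proof.
have P0 : (0 < p ^ n)%N by rewrite expn_gt0 prime_gt0.
elim: j => [|j IHj] jP; first by rewrite bin0 subrr absv0 mul0r.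
have -> : 'C((p ^ n).-1, j.+1)%:R - (-1) ^+ j.+1
   = 'C(p ^ n, j.+1)%:R - ('C((p ^ n).-1, j)%:R - (-1) ^+ j) :> K.
  by rewrite -[in 'C(p ^ n, _)](prednK P0) binS natrD exprS; ring.
have pn0 : 0 <= p%:R^-1 ^+ n :> R by rewrite exprn_ge0// invr_ge0 ler0n.
apply: absvB_le; last first.
  by apply: le_trans (IHj (ltnW jP)) _; rewrite ler_wpM2r// ler_nat.
have -> : 'C(p ^ n, j.+1)%:R
   = (j.+1%:R^-1 * p%:R ^+ n) * 'C((p ^ n).-1, j)%:R :> K.
  apply: (mulfI (natK_neq0 (ltn0Sn j))).
  by rewrite -natrM -mul_bin_diag natrM natrX !mulrA divff ?mul1r ?natK_neq0.
rewrite -[leRHS]mulr1 !(absvM K_Cp) absvX (absv_p K_Cp).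
by rewrite !ler_pM ?mulr_ge0 ?(absv_ge0 K_Cp) ?absv_natV ?absv_nat.
Qed.

(* The coefficient of [(x - 1) ^+ i] on the left is ['C(p ^ n - 1, i - 1) / i],
   and ['C(p ^ n - 1, i - 1)] tends p-adically to [(-1) ^+ (i - 1)]. *)
Lemma plog_lim x : absv (x - 1) < 1 ->
  kcvg absv (fun n => (x ^+ (p ^ n) - 1) / (p ^ n)%:R) (plog absv x).
Proof.
move=> x1; apply/kcvgP => e e0; have /kcvgP/(_ e e0)[N0 HN0] := plog_cvg x1.
have [N1 HN1] := natr_expr_small (absv_ge0 K_Cp _) x1 e0.
have pV0 : 0 <= p%:R^-1 :> R by rewrite invr_ge0 ler0n.
have [N2 HN2] := expr_small (N1%:R * N1%:R) pV0 pV_lt1 e0.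
exists (maxn N0 N2) => n; rewrite geq_max => /andP[n0 n2].
have P0 : (0 < p ^ n)%N by rewrite expn_gt0 prime_gt0.
(* The partial sum of the logarithm series up to index [p^n] is inserted: one difference is compared
   term by term, the other is small by convergence of the series. *)
rewrite -(subrKA (\sum_(1 <= i < (p ^ n).+1) (-1) ^+ i.+1 * (x - 1) ^+ i / i%:R)).
apply: absvD_lt; last first.
  by apply/HN0/(leq_trans n0)/ltnW; rewrite ltnS ltnW// ltn_expl// prime_gt1.
set z := x - 1.
have -> : x ^+ (p ^ n) - 1 = \sum_(1 <= i < (p ^ n).+1) z ^+ i *+ 'C(p ^ n, i).
  have {1}-> : x = 1 + z by rewrite addrC subrK.
  rewrite exprDn -(big_mkord xpredT (fun i => 1 ^+ (p ^ n - i) * z ^+ i *+ 'C(p ^ n, i))).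
  rewrite big_ltn// bin0 expr0 expr1n mulr1 addrAC subrr add0r.
  by apply: eq_bigr => i _; rewrite expr1n mul1r.
rewrite mulr_suml -sumrB; apply: absv_sum_lt => // -[|i]; rewrite mem_index_iota//.
rewrite ltnS => iP _.
have -> : z ^+ i.+1 *+ 'C(p ^ n, i.+1) / (p ^ n)%:R
   - (-1) ^+ i.+2 * z ^+ i.+1 / i.+1%:R
   = ('C((p ^ n).-1, i)%:R - (-1) ^+ i) * (i.+1%:R^-1 * z ^+ i.+1).
  have binE : 'C(p ^ n, i.+1)%:R = i.+1%:R^-1 * (p ^ n)%:R * 'C((p ^ n).-1, i)%:R :> K.
    apply: (mulfI (natK_neq0 (ltn0Sn i))).
    by rewrite -natrM -mul_bin_diag natrM !mulrA divff ?mul1r ?natK_neq0.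
  rewrite -mulr_natr binE !exprS.
  move: (natK_neq0 P0) (natK_neq0 (ltn0Sn i)).
  move: (p ^ n)%:R i.+1%:R => a b a0 b0.
  by field; rewrite a0 b0.
rewrite (absvM K_Cp).
have zi : absv (i.+1%:R^-1 * z ^+ i.+1) <= i.+1%:R * absv z ^+ i.+1.
  by rewrite (absvM K_Cp) absvX ler_wpM2r ?exprn_ge0 ?(absv_ge0 K_Cp) ?absv_natV.
(* For indices from [N1] on, the factor [i * absv z^i] is already small. Below [N1], that factor and
   the binomial error are at most [N1] and [N1 p^(-n)], whence the constant [N1 * N1] in the choice
   of [N2]. *)
have [le_N1|lt_N1] := leqP N1 i.+1.
  apply: le_lt_trans (HN1 _ le_N1); apply: le_trans zi.
  rewrite ler_piMl ?(absv_ge0 K_Cp)// absvB_le ?absv_nat//.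
  by rewrite absvX absvN absv1 expr1n.
apply: le_lt_trans (HN2 _ n2); rewrite -mulrA mulrC.
have pn0 : 0 <= p%:R^-1 ^+ n :> R by rewrite exprn_ge0.
apply: ler_pM; rewrite ?(absv_ge0 K_Cp)//.
  apply: le_trans zi _; apply: le_trans (_ : i.+1%:R <= _); last by rewrite ler_nat ltnW.
  by rewrite ler_piMr ?ler0n// exprn_ile1 ?(absv_ge0 K_Cp)// ltW.
apply: le_trans (absv_bin_pexp iP) _.
by rewrite ler_wpM2r// ler_nat ltnW// ltnW.
Qed.

(** With [P = p^n], the identity [x^((w+1)P) - 1 = (x^(wP) - 1) x^P + (x^P - 1)] makes the limit
    formula additive in [w], since [x^P] tends to [1]. *)
Lemma plogX x w : absv (x - 1) < 1 -> plog absv (x ^+ w) = w%:R * plog absv x.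
Proof.
move=> x1; have xw1 : absv (x ^+ w - 1) < 1.
  exact: le_lt_trans (absv_expr_sub1 _ x1) x1.
apply: kcvg_unique (plog_lim xw1) _.
set l := plog absv x; apply/kcvgP => e e0.
elim: w {xw1} => [|w [N0 HN0]].
  by exists 0%N => n _; rewrite expr0 expr1n subrr mul0r mul0r subrr absv0.
have [N1 HN1] := (kcvgP _ _).1 (plog_lim x1) e e0.
have pV0 : 0 <= p%:R^-1 :> R by rewrite invr_ge0 ler0n.
(* The quotient [(x^P - 1) / P] is within [e] of [l], so [Num.max e (absv l)] bounds it and
   [x^P - 1] is at most [p^(-n)] times that bound. *)
have [N2 HN2] := expr_small (absv (w%:R * l) * Num.max e (absv l)) pV0 pV_lt1 e0.
exists (maxn N0 (maxn N1 N2)) => n; rewrite !geq_max => /and3P[/HN0 n0 /HN1 n1 /HN2 n2].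
have P0 : (p ^ n)%:R != 0 :> K by rewrite natK_neq0// expn_gt0 prime_gt0.
have -> : ((x ^+ w.+1) ^+ (p ^ n) - 1) / (p ^ n)%:R - w.+1%:R * l
  = (((x ^+ w) ^+ (p ^ n) - 1) / (p ^ n)%:R - w%:R * l) * x ^+ (p ^ n)
    + w%:R * l * (x ^+ (p ^ n) - 1) + ((x ^+ (p ^ n) - 1) / (p ^ n)%:R - l).
  rewrite exprS exprMn -natr1.
  by field; rewrite P0.
apply: absvD_lt => //; apply: absvD_lt; rewrite (absvM K_Cp).
  apply: le_lt_trans n0; rewrite ler_piMr ?(absv_ge0 K_Cp)//.
  by rewrite absvX exprn_ile1 ?(absv_ge0 K_Cp) ?absv_le1.
apply: le_lt_trans n2; rewrite -mulrA ler_wpM2l ?(absv_ge0 K_Cp)//.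
rewrite -[X in absv X <= _](divfK P0) (absvM K_Cp) natrX absvX (absv_p K_Cp).
rewrite ler_wpM2r ?exprn_ge0// -natrX -(subrK l (_ / _)) absvD_le//.
  by rewrite le_max ltW.
by rewrite le_max lexx orbT.
Qed.

(** * Absence of nontrivial roots of unity close to 1 *)

(** In the expansion of [(1 + z)^p - 1] the term [p z] strictly dominates: for [1 < i < p] because
    [p] divides [C(p, i)] and [absv z < 1], for [i = p] because [absv z^(p-1) < 1/p]. Hence the sum
    cannot vanish. *)
Lemma expr_p_neq1 x : x != 1 -> absv (x - 1) ^+ p.-1 < p%:R^-1 -> x ^+ p != 1.
Proof.
move=> xn1 xp; rewrite -subr_eq0 subrX1 mulf_eq0 subr_eq0 (negbTE xn1) /=.
have x1 : absv (x - 1) < 1.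
  rewrite ltNge; apply/negP => ge1; move: xp; apply/negP; rewrite -leNgt.
  by apply: le_trans (ltW pV_lt1) _; exact: exprn_ege1.
set z := x - 1 in xp x1.
have z0 : z != 0 by rewrite subr_eq0.
apply/eqP => S0.
have zp : \sum_(1 <= i < p.+1) z ^+ i *+ 'C(p, i) = 0.
  have : x ^+ p - 1 = 0 by rewrite subrX1 S0 mulr0.
  have {1}-> : x = 1 + z by rewrite addrC subrK.
  rewrite exprDn -(big_mkord xpredT (fun i => 1 ^+ (p - i) * z ^+ i *+ 'C(p, i))).
  rewrite big_ltn// bin0 expr0 expr1n mulr1 addrAC subrr add0r => E.
  rewrite -[RHS]E.
  by apply: eq_bigr => i _; rewrite expr1n mul1r.
move: zp; rewrite big_ltn ?ltnS ?prime_gt0// bin1 expr1 => /eqP.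
rewrite addr_eq0 => /eqP zp.
suff : absv (z *+ p) < absv z * p%:R^-1.
  by rewrite -mulr_natr (absvM K_Cp) (absv_p K_Cp) ltxx.
rewrite zp absvN; apply: absv_sum_lt => [|[|i]].
- by rewrite mulr_gt0 ?absv_gt0 ?invr_gt0.
- by rewrite mem_index_iota.
rewrite mem_index_iota !ltnS => /andP[i0 ip] _; rewrite exprS -mulrnAr.
rewrite (absvM K_Cp) ltr_pM2l ?absv_gt0//.
have [iE|ne] := eqVneq i.+1 p.
  by rewrite iE binn mulr1n absvX; move: xp; rewrite -{1}iE.
have lt_ip : (i.+1 < p)%N by rewrite ltn_neqAle ne.
have /dvdnP[k ->] : (p %| 'C(p, i.+1))%N by rewrite prime_dvd_bin.
rewrite -mulr_natr natrM !(absvM K_Cp) (absv_p K_Cp) mulrA -[ltRHS]mul1r.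
rewrite ltr_pM2r ?invr_gt0//; apply: le_lt_trans (_ : absv z < 1) => //.
rewrite -[leRHS]mulr1 ler_pM ?(absv_ge0 K_Cp) ?absv_nat//.
by rewrite absvX -[leRHS]expr1 ler_wiXn2l// ?(absv_ge0 K_Cp)// ltW.
Qed.

(** If [1 + x + ... + x^(m-1)] vanished, [m] would be minus the sum of the [x^i - 1], of absolute
    value less than [1], although [m] is a p-adic unit. *)
Lemma expr_coprime_neq1 x m :
  x != 1 -> absv (x - 1) < 1 -> coprime p m -> x ^+ m != 1.
Proof.
move=> xn1 x1 cpm; rewrite -subr_eq0 subrX1 mulf_eq0 subr_eq0 (negbTE xn1) /=.
apply/eqP => S0; suff : absv m%:R < 1 by rewrite absv_coprime// ltxx.
have -> : m%:R = - \sum_(i < m) (x ^+ i - 1).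
  by rewrite sumrB S0 sub0r opprK sumr_const card_ord.
rewrite absvN; apply: absv_sum_lt => // i _ _.
exact: le_lt_trans (absv_expr_sub1 _ x1) x1.
Qed.

Lemma expr_neq1 x w :
  x != 1 -> absv (x - 1) ^+ p.-1 < p%:R^-1 -> absv (x - 1) < 1 -> (0 < w)%N ->
  x ^+ w != 1.
Proof.
move=> xn1 xp x1 w0; have [m cpm ->] := pfactor_coprime p_prime w0.
have pk k : x ^+ (p ^ k) != 1 /\ absv (x ^+ (p ^ k) - 1) < 1.
  split; last exact: le_lt_trans (absv_expr_sub1 _ x1) x1.
  elim: k => [|k IHk]; first by rewrite expn0 expr1.
  rewrite expnSr exprM; apply: expr_p_neq1 => //; apply: le_lt_trans xp.
  by rewrite lerXn2r ?nnegrE ?(absv_ge0 K_Cp)// absv_expr_sub1.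
by rewrite mulnC exprM; have [? ?] := pk (logn p w); exact: expr_coprime_neq1.
Qed.

(** Raising to the power [p - 1] trades the real exponent for the integral condition used in the
    term comparison. *)
Lemma near1_expr (r : R) : 0 <= r -> r < p%:R `^ (- (p%:R - 1)^-1) ->
  r ^+ p.-1 < p%:R^-1 /\ r < 1.
Proof.
move=> r0 hr; have p1 : (0 < p.-1)%N by rewrite -subn1 subn_gt0 prime_gt1.
have rp : r ^+ p.-1 < p%:R^-1.
  have <- : (p%:R `^ (- (p%:R - 1)^-1)) ^+ p.-1 = p%:R^-1 :> R.
    rewrite -powR_mulrn ?powR_ge0// -powRrM -subn1 natrB ?prime_gt0//.
    rewrite mulNr mulVf ?powR_inv1 ?ler0n//.
    by rewrite subr_eq0 pnatr_eq1 gtn_eqF ?prime_gt1.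
  by rewrite ltrXn2r ?nnegrE ?powR_ge0// -lt0n.
split=> //; rewrite ltNge; apply/negP => ge1; move: rp; apply/negP; rewrite -leNgt.
by apply: le_trans (ltW pV_lt1) _; exact: exprn_ege1.
Qed.

End Padic.

(** * The symmetric generating function *)

Section GeneratingFunction.
Variables (R : realType) (K : fieldType) (absv : K -> R) (q : K).
(** These facts carry the p-adic input; what follows is algebra of formal power series. *)
Hypothesis fact_neq0 : forall i, i`!%:R != 0 :> K.
Hypothesis expr_neq1 : forall w, (0 < w)%N -> q ^+ w != 1.
Hypothesis plog_expr : forall w, plog absv (q ^+ w) = w%:R * plog absv q.

(* [(q e^t) ^ c] *)
Definition qexp (c : nat) : fps K := fun n => q ^+ c * expf c%:R n.

Lemma qexp0 : qexp 0 = 1.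
Proof.
apply/funext => n; rewrite /qexp /expf /fps_exp fps1E mul1r expr0n.
by case: n => [|n]; rewrite ?mul0r// fact0 invr1 mulr1.
Qed.

Lemma qexpD c d : qexp (c + d) = qexp c * qexp d.
Proof.
apply/funext => n; rewrite /qexp natrD expfD// !fpsME /fps_mul mulr_sumr.
by apply: eq_bigr => i _; rewrite exprD mulrACA.
Qed.

Lemma qexpM c i : qexp (c * i) = qexp c ^+ i.
Proof. by elim: i => [|i IHi]; rewrite ?muln0 ?qexp0// mulnS qexpD IHi exprS. Qed.

Definition qexp_inv (c : nat) : fps K := fps_inv (qexp c - 1).

Lemma qexp_invP c : (0 < c)%N -> qexp_inv c * (qexp c - 1) = 1.
Proof.
move=> c0; apply: fps_mulVr; rewrite fpsBE fps1E /qexp /expf /fps_exp.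
by rewrite expr0 fact0 invr1 !mulr1 subr_eq0 expr_neq1.
Qed.

Definition qlog : fps K := fun n => ((plog absv q)%:P + 'X)`_n.

(** Replacing [t] by [c t] turns [log (q^c) + t] into [c (log q + t)] and [q^c e^t - 1] into
    [U^c - 1], with [U = q e^t]. *)
Lemma scale_qbern_gf c : (0 < c)%N ->
  fps_scale c%:R (qbern_gf absv (q ^+ c)) = c%:R * qlog * qexp_inv c.
Proof.
move=> c0; pose d : fps K := fun n => q ^+ c * fps_exp 1 n - (n == 0%N)%:R.
pose L : fps K := fun n => ((plog absv (q ^+ c))%:P + 'X)`_n.
have d0 : d 0%N != 0.
  by rewrite /d /fps_exp expr0 fact0 invr1 !mulr1 subr_eq0 expr_neq1.
have -> : qbern_gf absv (q ^+ c) = L * (fps_inv d : fps K) by [].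
have dE : fps_scale c%:R d = qexp c - 1.
  apply/funext => n; rewrite /fps_scale /d fpsBE fps1E /qexp /expf /fps_exp.
  by rewrite expr1n; case: n => [|n] /=; rewrite ?expr0 ?subr0; ring.
have LE : fps_scale c%:R L = c%:R * qlog.
  apply/funext => n; rewrite fps_natlE /fps_scale /L /qlog !coefE plog_expr.
  by case: n => [|[|n]] /=; ring.
rewrite fps_scaleM LE; congr (_ * _).
(* Uniqueness of inverses: the scaled inverse of [d] and [qexp_inv c] both invert [U^c - 1]. *)
rewrite -[LHS]mulr1 -(qexp_invP c0) -dE mulrCA.
by rewrite -fps_scaleM fps_mulVr// fps_scale1 mulr1.
Qed.

Lemma qexp_sum c w :
  (\sum_(i < w) qexp (c * i)) * (qexp c - 1) = qexp (c * w) - 1.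
Proof.
by rewrite mulrC qexpM subrX1; congr (_ * _); apply: eq_bigr => i _; exact: qexpM.
Qed.

(** After [t] becomes [c t], the exponential generating function of the power sums is the geometric
    sum of the [U^(c i)], [i < w]. *)
Lemma qpowsum_qexp c w m : (0 < w)%N ->
  qpowsum (q ^+ c) m (w - 1) * c%:R ^+ m =
  m`!%:R * (\sum_(i < w) qexp (c * i)) m.
Proof.
move=> w0; rewrite fps_sumE /qpowsum subn1 prednK// mulr_suml mulr_sumr.
apply: eq_bigr => i _; rewrite /qexp /expf /fps_exp exprM natrM exprMn.
by field; rewrite fact_neq0.
Qed.

(** The six expressions of the theorem are the values of this one at the permutations of
    [(w1, w2, w3)]. The last exponent is an integer because it equals [-1] at [k = l = 0]. *)
Definition qbern3 (n a b c : nat) (y1 y2 : K) : K :=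
  trinomial_sum n (fun k l m =>
      qbern absv (q ^+ (b * c)) k (a%:R * y1)
      * qbern absv (q ^+ (a * c)) l (b%:R * y2)
      * qpowsum (q ^+ (a * b)) m (c - 1)%N
      * a%:R ^+ (l + m) * b%:R ^+ (k + m) * c%:R ^ ((k + l)%:Z - 1)).

Definition qbern3_gf (a b c : nat) (y1 y2 : K) : fps K :=
  (a * b * c)%:R * qlog ^+ 2 * (qexp (a * b * c) - 1)
  * (expf ((a * b * c)%:R * y1) * expf ((a * b * c)%:R * y2))
  * (qexp_inv (a * b) * qexp_inv (a * c) * qexp_inv (b * c)).

(** The weight [a^(l+m) b^(k+m) c^(k+l-1)] equals [c^(-1) (bc)^k (ac)^l (ab)^m], so each factor is a
    generating function with scaled variable. The scalar [c^(-1)] cancels the surplus [c] in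
    [(bc)(ac) = c (abc)]. *)
Lemma qbern3E n a b c y1 y2 : (0 < a)%N -> (0 < b)%N -> (0 < c)%N ->
  c%:R != 0 :> K ->
  qbern3 n a b c y1 y2 = n`!%:R * qbern3_gf a b c y1 y2 n.
Proof.
move=> a0 b0 c0 cK.
pose B d : fps K := qbern_gf absv (q ^+ d).
have BE d : (0 < d)%N -> fps_scale d%:R (B d) = d%:R * qlog * qexp_inv d.
  exact: scale_qbern_gf.
pose f := fps_scale (b * c)%:R (B (b * c)%N * expf (a%:R * y1)).
pose g := fps_scale (a * c)%:R (B (a * c)%N * expf (b%:R * y2)).
pose h : fps K := \sum_(i < c) qexp (a * b * i).
rewrite /qbern3 (@trinomial_sum_fps _ f g h _ c%:R^-1)//; last first.
  move=> k l m; rewrite /h -qpowsum_qexp// /f /g /fps_scale /qbern.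
  rewrite !fpsME /B /expf expfzDr// exprN1 -exprnP !natrM !exprMn !exprD.
  ring.
congr (_ * _).
have -> : f * g * h = c%:R * qbern3_gf a b c y1 y2.
  rewrite /f fps_scaleM BE ?muln_gt0 ?b0// /g fps_scaleM BE ?muln_gt0 ?a0//.
  rewrite !fps_scale_exp.
  have hE : h = (qexp (a * b * c) - 1) * qexp_inv (a * b).
    rewrite -qexp_sum -mulrA [_ * qexp_inv _]mulrC qexp_invP ?mulr1//.
    by rewrite muln_gt0 a0.
  rewrite hE /qbern3_gf.
  have -> : (b * c)%:R * (a%:R * y1) = (a * b * c)%:R * y1 by rewrite !natrM; ring.
  have -> : (a * c)%:R * (b%:R * y2) = (a * b * c)%:R * y2 by rewrite !natrM; ring.
  by rewrite !natrM; ring.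
by rewrite fps_natlE mulKf.
Qed.

(** This and the next symmetry are the two adjacent transpositions, which generate all permutations
    of the triple. *)
Lemma qbern3_gfCl a b c y1 y2 : qbern3_gf a b c y1 y2 = qbern3_gf b a c y1 y2.
Proof. by rewrite /qbern3_gf (mulnC b a); ring. Qed.

Lemma qbern3_gfCr a b c y1 y2 : qbern3_gf a b c y1 y2 = qbern3_gf a c b y1 y2.
Proof. by rewrite /qbern3_gf (mulnC c b) (mulnAC a c b); ring. Qed.

End GeneratingFunction.

(** * Equality of the six permuted expressions *)

Theorem theorem4p2 (R : realType) (p : nat) (p_prime : prime p)
    (K : fieldType) (absv : K -> R) (K_Cp : is_Cp absv p)
    (q : K) (q_neq1 : q != 1)
    (q_near1 : absv (q - 1) < p%:R `^ (- (p%:R - 1)^-1))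
    (w1 w2 w3 : nat) (w1_gt0 : (0 < w1)%N) (w2_gt0 : (0 < w2)%N)
    (w3_gt0 : (0 < w3)%N) (n : nat)
    (y1 y2 : K) (y1_Zp : padicZ absv y1) (y2_Zp : padicZ absv y2) :
  let B (k : nat) (Q x : K) := qbern absv Q k x in
  let S (m : nat) (Q : K) (N : nat) := qpowsum Q m N in
  let E1 := trinomial_sum n (fun k l m =>
      B k (q ^+ (w2 * w3)) (w1%:R * y1) * B l (q ^+ (w1 * w3)) (w2%:R * y2)
      * S m (q ^+ (w1 * w2)) (w3 - 1)%N
      * w1%:R ^+ (l + m) * w2%:R ^+ (k + m) * w3%:R ^ ((k + l)%:Z - 1)) in
  let E2 := trinomial_sum n (fun k l m =>
      B k (q ^+ (w2 * w3)) (w1%:R * y1) * B l (q ^+ (w1 * w2)) (w3%:R * y2)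
      * S m (q ^+ (w1 * w3)) (w2 - 1)%N
      * w1%:R ^+ (l + m) * w3%:R ^+ (k + m) * w2%:R ^ ((k + l)%:Z - 1)) in
  let E3 := trinomial_sum n (fun k l m =>
      B k (q ^+ (w1 * w3)) (w2%:R * y1) * B l (q ^+ (w2 * w3)) (w1%:R * y2)
      * S m (q ^+ (w1 * w2)) (w3 - 1)%N
      * w2%:R ^+ (l + m) * w1%:R ^+ (k + m) * w3%:R ^ ((k + l)%:Z - 1)) in
  let E4 := trinomial_sum n (fun k l m =>
      B k (q ^+ (w1 * w3)) (w2%:R * y1) * B l (q ^+ (w1 * w2)) (w3%:R * y2)
      * S m (q ^+ (w2 * w3)) (w1 - 1)%N
      * w2%:R ^+ (l + m) * w3%:R ^+ (k + m) * w1%:R ^ ((k + l)%:Z - 1)) in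
  let E5 := trinomial_sum n (fun k l m =>
      B k (q ^+ (w1 * w2)) (w3%:R * y1) * B l (q ^+ (w1 * w3)) (w2%:R * y2)
      * S m (q ^+ (w2 * w3)) (w1 - 1)%N
      * w3%:R ^+ (l + m) * w2%:R ^+ (k + m) * w1%:R ^ ((k + l)%:Z - 1)) in
  let E6 := trinomial_sum n (fun k l m =>
      B k (q ^+ (w1 * w2)) (w3%:R * y1) * B l (q ^+ (w2 * w3)) (w1%:R * y2)
      * S m (q ^+ (w1 * w3)) (w2 - 1)%N
      * w3%:R ^+ (l + m) * w1%:R ^+ (k + m) * w2%:R ^ ((k + l)%:Z - 1)) in
  [/\ E1 = E2, E2 = E3, E3 = E4, E4 = E5 & E5 = E6].
Proof.
have [q_exp q_lt1] := near1_expr p_prime (absv_ge0 K_Cp _) q_near1.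
move=> B S.
have key a b c : (0 < a)%N -> (0 < b)%N -> (0 < c)%N ->
    qbern3 absv q n a b c y1 y2 = n`!%:R * qbern3_gf absv q a b c y1 y2 n.
  move=> a0 b0 c0; apply: qbern3E => //.
  - exact: factK_neq0 K_Cp.
  - by move=> w; exact: (expr_neq1 p_prime K_Cp).
  - by move=> w; exact: (plogX p_prime K_Cp).
  - exact: natK_neq0 K_Cp _ c0.
have symC a b c (a0 : (0 < a)%N) (b0 : (0 < b)%N) (c0 : (0 < c)%N) :
    qbern3 absv q n a b c y1 y2 = qbern3 absv q n b a c y1 y2.
  by rewrite !key// qbern3_gfCl.
have symR a b c (a0 : (0 < a)%N) (b0 : (0 < b)%N) (c0 : (0 < c)%N) :
    qbern3 absv q n a b c y1 y2 = qbern3 absv q n a c b y1 y2.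
  by rewrite !key// qbern3_gfCr.
move=> E1 E2 E3 E4 E5 E6.
(* Each expression is an instance of [qbern3] up to the order of the factors in the exponents of
   [q]. *)
have e1 : E1 = qbern3 absv q n w1 w2 w3 y1 y2 by [].
have e2 : E2 = qbern3 absv q n w1 w3 w2 y1 y2.
  by rewrite /qbern3 (mulnC w3 w2).
have e3 : E3 = qbern3 absv q n w2 w1 w3 y1 y2.
  by rewrite /qbern3 (mulnC w2 w1).
have e4 : E4 = qbern3 absv q n w2 w3 w1 y1 y2.
  by rewrite /qbern3 (mulnC w3 w1) (mulnC w2 w1).
have e5 : E5 = qbern3 absv q n w3 w2 w1 y1 y2.
  by rewrite /qbern3 (mulnC w2 w1) (mulnC w3 w1) (mulnC w3 w2).
have e6 : E6 = qbern3 absv q n w3 w1 w2 y1 y2.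
  by rewrite /qbern3 (mulnC w3 w2) (mulnC w3 w1).
rewrite e1 e2 e3 e4 e5 e6; split.
- exact: symR.
(* The passage from [(w1, w3, w2)] to [(w2, w1, w3)] is a 3-cycle and takes two transpositions. *)
- by rewrite symR// symC.
- exact: symR.
- exact: symC.
- exact: symR.
Qed.
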